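(* Let $\mathcal{A}$ be an essential arrangement of projective planes in $\mathbb{P}^3(\mathbb{R})$. Then $$f_2(\mathcal{A})=\sum_{H\in\mathcal{A}}r(\mathcal{A}^H).$$ Consequently, $\mathcal{A}$ is simplicial if and only if $$\sum_{H\in\mathcal{A}}r(\mathcal{A}^H)=2\,r(\mathcal{A}).$$
   Context: An arrangement $\mathcal{A}$ in $\mathbb{P}^3(\mathbb{R})=\mathbb{P}(V)$, $V$ a 4-dimensional real vector space, is a finite set of distinct projective planes $H=\mathbb{P}(\ker a_H)$, $a_H\in V^*\setminus\{0\}$. It is essential if the covectors $a_H$ span $V^*$. A chamber is a connected component of the complement of the union of the arrangement. An essential arrangement is simplicial if the closure of every chamber is combinatorially a tetrahedron; equivalently, every chamber has exactly four facets. $f_2(\mathcal{A})$ is the number of two-dimensional cells of the cell decomposition of $\mathbb{P}^3(\mathbb{R})$ induced by $\mathcal{A}$, i.e. the total number of connected components of $H\setminus\bigcup_{H'\in\mathcal{A}\setminus\{H\}}H'$ over all $H\in\mathcal{A}$. For $H\in\mathcal{A}$, the reduced restriction $\mathcal{A}^H$ is the set of distinct projective lines $H\cap H'$, $H'\in\mathcal{A}\setminus\{H\}$ (repetitions removed), viewed as a line arrangement in $H\simeq\mathbb{P}^2(\mathbb{R})$. For a real projective arrangement $\mathcal{B}$, $r(\mathcal{B})$ denotes the number of chambers of $\mathcal{B}$ in its ambient projective space. *)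

(* Defs.v *)
From HB Require Import structures.
From mathcomp Require Import all_boot all_order all_algebra finmap generic_quotient.
From mathcomp Require Import all_classical all_reals all_analysis.

Set Implicit Arguments.
Unset Strict Implicit.
Unset Printing Implicit Defensive.
Import Order.TTheory GRing.Theory Num.Theory.
Import numFieldNormedType.Exports.
Local Open Scope classical_set_scope.
Local Open Scope ring_scope.
Local Open Scope quotient_scope.

Section ProjectiveSpace.
Context (R : realType) (n : nat).

Definition nonzero : set 'rV[R]_n := [set v | v != 0].

Definition collinear (u v : nonzero) : bool :=
  `[< exists2 c : R, c != 0 & set_val v = c *: set_val u >].

Lemma collinear_refl : reflexive collinear.
Proof. by move=> u; apply/asboolP; exists 1; rewrite ?oner_neq0 ?scale1r. Qed.

Lemma collinear_sym : symmetric collinear.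
Proof.
suff sym u v : collinear u v -> collinear v u by move=> u v; apply/idP/idP; apply: sym.
move=> /asboolP[c c0 vE]; apply/asboolP; exists c^-1; first by rewrite invr_eq0.
by rewrite vE scalerA mulVf// scale1r.
Qed.

Lemma collinear_trans : transitive collinear.
Proof.
move=> v u w /asboolP[c c0 vE] /asboolP[d d0 wE].
by apply/asboolP; exists (d * c); rewrite ?mulf_neq0// wE vE scalerA.
Qed.

Canonical collinear_equiv :=
  EquivRel collinear collinear_refl collinear_sym collinear_trans.

(* P(V) for V = R^n (so of projective dimension n - 1), with the quotient
   topology inherited from V \ {0}. *)
Definition proj_space := quotient_topology {eq_quot collinear_equiv}.

HB.instance Definition _ := Topological.on proj_space.
HB.instance Definition _ := Quotient.on proj_space.

(* Covectors are columns, evaluated on a row vector v as v *m a. *)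
Definition proj_ker (a : 'cV[R]_n) : set proj_space :=
  [set \pi_proj_space v | v in [set v : nonzero | set_val v *m a = 0]].

(* Arrangements are sets of hyperplanes rather than families of covectors, so
   that their members are automatically distinct. *)
Definition arrangement (A : set (set proj_space)) : Prop :=
  finite_set A /\ forall H, A H -> exists2 a, a != 0 & H = proj_ker a.

Definition essential (A : set (set proj_space)) : Prop :=
  exists2 X : seq 'cV[R]_n,
    (forall a, a \in X -> a != 0 /\ A (proj_ker a)) & <<X>>%VS = fullv.

End ProjectiveSpace.

(* The cardinality of a finite set (0 on infinite sets). *)
Definition ncard (T : choiceType) (A : set T) : nat := #|` fset_set A|%fset.

Section Cells.
Context {T : topologicalType}.
Implicit Types (X C : set T) (A B : set (set T)).

Definition components X : set (set T) :=
  [set connected_component X x | x in X].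

(* The arrangement B lives in the ambient space X, e.g. X = setT for an
   arrangement of planes, and X a plane for its restriction to that plane. *)
Definition chambers X B : set (set T) :=
  components (X `\` \bigcup_(H in B) H).

Definition num_chambers X B : nat := ncard (chambers X B).

Definition restriction A (H : set T) : set (set T) :=
  [set H `&` H' | H' in A `\ H].

Definition two_cells A : set (set T) :=
  \bigcup_(H in A) components (H `\` \bigcup_(H' in A `\ H) H').

Definition f2 A : nat := ncard (two_cells A).

(* Cells of all dimensions: the components of the loci of the points whose
   incident members of A are exactly those of a given B. *)
Definition cells A : set (set T) :=
  \bigcup_(B in [set B | B `<=` A])
    components ((\bigcap_(H in B) H) `\` \bigcup_(H in A `\` B) H).

Definition faces A C : set (set T) := [set F | cells A F /\ F `<=` closure C].

(* The nonempty faces of the closure of C (each represented by its open cell,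
   and C itself included) form a poset isomorphic to the nonempty faces of the
   tetrahedron, i.e. to the nonempty subsets of its four vertices. *)
Definition tetrahedral A C : Prop :=
  exists2 phi : {set 'I_4} -> set T,
    set_bij [set S : {set 'I_4} | S != finset.set0] (faces A C) phi &
    forall S S' : {set 'I_4}, S != finset.set0 -> S' != finset.set0 ->
      (S \subset S' <-> phi S `<=` closure (phi S')).

Definition simplicial A : Prop :=
  forall C, chambers [set: T] A C -> tetrahedral A C.

End Cells.

(* Main.v *)
Require Import Defs.
From HB Require Import structures.
From mathcomp Require Import all_boot all_order all_algebra finmap.
From mathcomp Require Import all_classical all_reals all_analysis.

(** Choose a covector for each plane of the arrangement. The sign vectors of the
    points of R^4 then index the cells: a cell is the image of the cone of all
    points with a given sign vector, and two sign vectors give the same cell iff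
    they agree up to a global sign. Such images are connected, and relatively
    open and closed in the locus of their zero set, so they are the components;
    cell inclusion in closures is the order of sign vectors.

    A ray from a generic interior point of a chamber cone leaves it through a
    single wall, so the cone is cut out by its walls. Hence the walls of a
    chamber span the dual space: there are at least four, and if there are
    exactly four the face lattice is Boolean. Conversely the walls are coatoms
    of the face lattice, so a tetrahedral chamber has at most four. Each
    two-dimensional cell is a wall of two chambers, so the numbers of walls of
    the chambers add up to twice the number of two-dimensional cells, which
    compares the latter with [2 r(A)]. *)

Set Implicit Arguments.
Unset Strict Implicit.
Unset Printing Implicit Defensive.
Import Order.TTheory GRing.Theory Num.Theory.
Import numFieldNormedType.Exports.
Local Open Scope classical_set_scope.
Local Open Scope ring_scope.
Local Open Scope quotient_scope.

(** * Points of projective space *)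

Section ProjectivePoints.
Context (R : realType) (n : nat).
Local Notation P := (proj_space R n.+1).
Implicit Types v w : 'rV[R]_n.+1.

Lemma const1_nonzero : (const_mx 1 : 'rV[R]_n.+1) \in @nonzero R n.+1.
Proof.
apply/mem_set/eqP => /rowP/(_ 0); rewrite !mxE.
by move/eqP; rewrite oner_eq0.
Qed.

(* The class of [v] in P(R^(n+1)); the point assigned to [v = 0] is junk. *)
Definition proj_pt v : P := \pi_P (insubd (SigSub const1_nonzero) v).

Lemma pi_proj_pt (u : @nonzero R n.+1) : \pi_P u = proj_pt (set_val u).
Proof. by rewrite /proj_pt valKd. Qed.

Lemma nonzero_val (u : @nonzero R n.+1) : set_val u != 0.
Proof. exact: (set_mem (valP u)). Qed.

Lemma proj_ptP (q : P) : exists2 v, v != 0 & proj_pt v = q.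
Proof.
exists (set_val (repr q)); first exact: nonzero_val.
by rewrite -pi_proj_pt reprK.
Qed.

Lemma eq_proj_pt v w : v != 0 -> w != 0 ->
  proj_pt v = proj_pt w <-> exists2 c, c != 0 & w = c *: v.
Proof.
have valE u : u != 0 -> set_val (insubd (SigSub const1_nonzero) u) = u.
  by move=> u0; rewrite [set_val _](val_insubd _ u) mem_set.
move=> v0 w0; rewrite /proj_pt; split.
  by move=> /(@eqmodP _ (collinear_equiv R n.+1))/asboolP; rewrite !valE.
by move=> h; apply/(@eqmodP _ (collinear_equiv R n.+1))/asboolP; rewrite !valE.
Qed.

Lemma proj_ptZ c v : c != 0 -> v != 0 -> proj_pt (c *: v) = proj_pt v.
Proof.
move=> c0 v0; apply/esym/eq_proj_pt; rewrite ?scaler_eq0 ?negb_or ?c0//.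
by exists c.
Qed.

Lemma proj_kerP (a : 'cV[R]_n.+1) v : v != 0 ->
  proj_ker a (proj_pt v) <-> v *m a = 0.
Proof.
move=> v0; split=> [[u /= ua]|va].
  rewrite pi_proj_pt => /(eq_proj_pt (nonzero_val u) v0)[c _ ->].
  by rewrite -scalemxAl ua scaler0.
exists (SigSub (mem_set v0 : v \in @nonzero R n.+1)) => //.
by rewrite pi_proj_pt.
Qed.

Lemma open_nonzero : open (@nonzero R n.+1).
Proof.
have -> : @nonzero R n.+1 =
    \bigcup_(i in [set: 'I_n.+1]) [set v : 'rV_n.+1 | v 0 i != 0].
  apply/seteqP; split=> v /=.
    by move=> /rV0Pn[i vi]; exists i.
  by move=> [i _ /= vi]; apply/rV0Pn; exists i.
apply: bigcup_open => i _.
apply: (@open_comp _ _ (fun v : 'rV[R]_n.+1 => v 0 i) [set x | x != 0]).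
  by move=> v _; exact: coord_continuous.
exact: open_neq.
Qed.

(** The nonzero vectors form an open set, so openness relative to them is openness in the whole
    vector space. *)
Lemma open_proj_ptP (O : set P) :
  open O <-> open [set v | v != 0 /\ O (proj_pt v)].
Proof.
split.
  rewrite {1}/open /= /quotient_open => -[W oW WE].
  have -> : [set v | v != 0 /\ O (proj_pt v)] = @nonzero R n.+1 `&` W.
    have OW v (v0 : v != 0) : O (proj_pt v) <-> W v.
      pose u : @nonzero R n.+1 := SigSub (mem_set v0 : v \in @nonzero R n.+1).
      have := congr1 (fun X => X u) WE.
      by rewrite /preimage/= => ->; rewrite pi_proj_pt.
    by apply/seteqP; split=> v /= [v0 h]; split=> //; apply/(OW v v0).
  exact: openI open_nonzero oW.
move=> oO; rewrite /open /= /quotient_open.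
exists [set v | v != 0 /\ O (proj_pt v)] => //.
apply/seteqP; split=> u /=; first by rewrite pi_proj_pt => -[].
by rewrite pi_proj_pt => Ou; split => //; exact: nonzero_val.
Qed.

Lemma proj_pt_continuous : {in @nonzero R n.+1, continuous proj_pt}.
Proof.
move=> v /set_mem v0 U; rewrite nbhsE => -[W [oW Wv] sWU].
rewrite nbhs_simpl /=; apply: (@filterS _ _ _ [set w | w != 0 /\ W (proj_pt w)]).
  by move=> w [_ /sWU].
by apply: open_nbhs_nbhs; split => //; exact/open_proj_ptP.
Qed.

(** Stability under scaling makes [Q] saturated: on nonzero vectors it is the whole preimage of its
    image. *)
Lemma open_proj_set (Q : set 'rV[R]_n.+1) :
  (forall c v, c != 0 -> Q v -> Q (c *: v)) -> open Q ->
  open (proj_pt @` [set v | v != 0 /\ Q v]).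
Proof.
move=> QZ oQ; apply/open_proj_ptP.
have -> : [set v | v != 0 /\ (proj_pt @` [set v | v != 0 /\ Q v]) (proj_pt v)] =
    @nonzero R n.+1 `&` Q.
  apply/seteqP; split=> v /= [v0].
    move=> [w [w0 Qw]] /(eq_proj_pt w0 v0)[c c0 ->].
    by split; [rewrite /nonzero/= scaler_eq0 negb_or c0|exact: QZ].
  by move=> Qv; split => //; exists v.
exact: openI open_nonzero oQ.
Qed.

Lemma closed_proj_set (Q : set 'rV[R]_n.+1) :
  (forall c v, c != 0 -> Q v -> Q (c *: v)) -> closed Q ->
  closed (proj_pt @` [set v | v != 0 /\ Q v]).
Proof.
move=> QZ cQ; rewrite -[X in closed X]setCK closedC.
have -> : ~` (proj_pt @` [set v | v != 0 /\ Q v]) =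
    proj_pt @` [set v | v != 0 /\ (~` Q) v].
  apply/seteqP; split=> [q|_ [v [v0 nQv] <-]] /=.
    have [v v0 <-] := proj_ptP q => nq; exists v => //; split => // Qv.
    by apply: nq; exists v.
  move=> [w [w0 Qw]] /(eq_proj_pt w0 v0)[c c0 vE].
  by apply: nQv; rewrite vE; exact: QZ.
apply: open_proj_set; last by rewrite openC.
move=> c v c0 nQ Qcv; apply: nQ.
by rewrite -[v](scalerK c0); apply: QZ => //; rewrite invr_eq0.
Qed.

Lemma linear_form_continuous (a : 'cV[R]_n.+1) :
  continuous (fun v : 'rV[R]_n.+1 => (v *m a) 0 0).
Proof.
have -> : (fun v : 'rV[R]_n.+1 => (v *m a) 0 0) =
    (fun v : 'rV[R]_n.+1 => \sum_j v 0 j * a j 0).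
  by apply/funext => v; rewrite mxE.
apply: continuous_big => //= [|j _ v]; first exact: add_continuous.
by apply: continuousM; [exact: coord_continuous|exact: cst_continuous].
Qed.

Lemma line_continuous v w : continuous (fun t : R => v + t *: w).
Proof.
move=> t; apply: cvgD; first exact: cvg_cst.
by apply: cvgZ; [exact: cvg_id|exact: cvg_cst].
Qed.

(** [K] is a union of segments issuing from one common point. *)
Lemma convex_connected (K : set 'rV[R]_n.+1) :
  (forall v w t, K v -> K w -> 0 <= t <= 1 -> K (v + t *: (w - v))) ->
  connected K.
Proof.
move=> Kconv; have [->|/set0P[v Kv]] := eqVneq K set0; first exact: connected0.
pose seg w := (fun t : R => v + t *: (w - v)) @` `[0, 1].
have -> : K = \bigcup_(w in K) seg w.
  apply/seteqP; split=> [w Kw|_ [w Kw [t + <-]]]; last first.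
    by rewrite /= in_itv /= => t01; exact: Kconv.
  by exists w => //; exists 1; rewrite /= ?in_itv /= ?ler01 ?lexx// scale1r subrKC.
apply: bigcup_connected.
  exists v => w Kw; exists 0; rewrite /= ?in_itv /= ?ler01 ?lexx//.
  by rewrite scale0r addr0.
move=> w Kw; apply: connected_continuous_connected; first exact: segment_connected.
by apply: continuous_subspaceT; exact: line_continuous.
Qed.

Lemma proj_convex_connected (K : set 'rV[R]_n.+1) : K `<=` @nonzero R n.+1 ->
  (forall v w t, K v -> K w -> 0 <= t <= 1 -> K (v + t *: (w - v))) ->
  connected (proj_pt @` K).
Proof.
move=> K0 Kconv; apply: connected_continuous_connected.
  exact: convex_connected.
apply: (continuous_subspaceW K0); rewrite continuous_open_subspace//.
  exact: proj_pt_continuous.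
exact: open_nonzero.
Qed.

End ProjectivePoints.
Arguments proj_pt {R n}.

(** * Signs of real numbers *)

Section Sign.
Context (R : realType).
Implicit Types x y c t : R.

(** The Boolean tells whether a nonzero number is positive. With [None] for zero, changing sign is
    [omap negb], and zero can serve as the bottom of an order in which the two signs are
    incomparable. *)
Definition sign x : option bool := if x == 0 then None else Some (0 < x).

Lemma sign0 : sign 0 = None. Proof. by rewrite /sign eqxx. Qed.

Lemma sign_eq0 x : (sign x == None) = (x == 0).
Proof. by rewrite /sign; case: ifP. Qed.

Lemma sign_eqT x : (sign x == Some true) = (0 < x).
Proof.
rewrite /sign; case: (eqVneq x 0) => [->|_]; first by rewrite ltxx.
by case: (0 < x).
Qed.

Lemma sign_eqF x : (sign x == Some false) = (x < 0).
Proof.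
rewrite /sign; case: (eqVneq x 0) => [->|x0]; first by rewrite ltxx.
by rewrite [RHS]ltNge le0r (negPf x0)/=; case: (0 < x).
Qed.

Lemma signN x : sign (- x) = omap negb (sign x).
Proof.
rewrite /sign oppr_eq0; case: (eqVneq x 0) => //= x0.
by rewrite oppr_gt0 [0 < x]lt0r x0 /= -ltNge.
Qed.

Lemma sign_pM c x : 0 < c -> sign (c * x) = sign x.
Proof. by move=> c0; rewrite /sign mulf_eq0 gt_eqF//= pmulr_rgt0. Qed.

Lemma sign_convex x y t : sign x = sign y -> 0 <= t <= 1 ->
  sign (x + t * (y - x)) = sign x.
Proof.
move=> sxy /andP[t0 t1].
have -> : x + t * (y - x) = (1 - t) * x + t * y.
  by rewrite mulrBr mulrBl mul1r addrCA addrC.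
move: sxy; rewrite /sign; case: (ltgtP x 0) => [x0|x0|->].
- case: (ltgtP y 0) => // y0 _.
  have lt0 : (1 - t) * x + t * y < 0.
    have [->|t0'] := eqVneq t 0; first by rewrite subr0 mul1r mul0r addr0.
    apply: ltr_nwDr; first by rewrite pmulr_rlt0// lt0r t0'.
    by rewrite mulr_ge0_le0 ?subr_ge0// ltW.
  by rewrite lt_eqF// ltNge ltW.
- case: (ltgtP y 0) => // y0 _.
  have gt0 : 0 < (1 - t) * x + t * y.
    have [->|t0'] := eqVneq t 0; first by rewrite subr0 mul1r mul0r addr0.
    apply: ltr_wpDl; last by rewrite pmulr_rgt0// lt0r t0'.
    by rewrite mulr_ge0 ?subr_ge0// ltW.
  by rewrite gt_eqF// gt0.
- by case: (eqVneq y 0) => // ->; rewrite !mulr0 addr0 eqxx.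
Qed.

(** This is the up-set of [s] when zero lies below both signs; down-sets are dually closed. Taken
    entrywise, these give the topology of the order [sv_le]. *)
Lemma open_sign (s : option bool) : open [set x | s = None \/ sign x = s].
Proof.
case: s => [[]|].
- rewrite [X in open X](_ : _ = [set x | 0 < x]); first exact: open_gt.
  apply/seteqP; split=> x /=; first by move=> [//|/eqP]; rewrite sign_eqT.
  by right; apply/eqP; rewrite sign_eqT.
- rewrite [X in open X](_ : _ = [set x | x < 0]); first exact: open_lt.
  apply/seteqP; split=> x /=; first by move=> [//|/eqP]; rewrite sign_eqF.
  by right; apply/eqP; rewrite sign_eqF.
- rewrite [X in open X](_ : _ = setT); first exact: openT.
  by apply/seteqP; split=> x //= _; left.
Qed.

Lemma closed_sign (s : option bool) : closed [set x | sign x = None \/ sign x = s].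
Proof.
case: s => [[]|].
- rewrite [X in closed X](_ : _ = [set x | 0 <= x]); first exact: closed_ge.
  apply/seteqP; split=> x /=.
    by move=> [] /eqP; rewrite ?sign_eqT ?sign_eq0; [move=> /eqP ->|move=> /ltW].
  by rewrite le_eqVlt eq_sym -sign_eq0 -sign_eqT => /orP[]/eqP; [left|right].
- rewrite [X in closed X](_ : _ = [set x | x <= 0]); first exact: closed_le.
  apply/seteqP; split=> x /=.
    by move=> [] /eqP; rewrite ?sign_eqF ?sign_eq0; [move=> /eqP ->|move=> /ltW].
  by rewrite le_eqVlt -sign_eq0 -sign_eqF => /orP[]/eqP; [left|right].
- rewrite [X in closed X](_ : _ = [set x | x = 0]); first exact: closed_eq.
  apply/seteqP; split=> x /=; first by move=> [] /eqP; rewrite sign_eq0 => /eqP.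
  by move=> ->; left; exact: sign0.
Qed.

(** By continuity a nonzero [x] keeps its sign after a small step; from zero, the direction of the
    step decides. *)
Lemma sign_near x y :
  \forall t \near 0^'+, sign (x + t * y) = if x == 0 then sign y else sign x.
Proof.
case: eqVneq => [->|x0].
  near=> t; rewrite add0r sign_pM//.
have cvt : x + t * y @[t --> 0^'+] --> x + 0 * y.
  apply: cvg_within_filter; apply: cvgD; first exact: cvg_cst.
  by apply: cvgM; [exact: cvg_id|exact: cvg_cst].
move: cvt; rewrite mul0r addr0 => cvt.
have : nbhs x [set z | sign x = None \/ sign z = sign x].
  by apply: open_nbhs_nbhs; split; [exact: open_sign|right].
move=> /cvt nb; near=> t.
have [/eqP|//] : sign x = None \/ sign (x + t * y) = sign x by near: t.
by rewrite sign_eq0 (negPf x0).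
Unshelve. all: by end_near.
Qed.
End Sign.

(** * Sign vectors *)

Section SignVector.
Context (I : finType).
Local Notation sv := {ffun I -> option bool}.
Implicit Types s t : sv.

Definition sv0 : sv := [ffun=> None].
Definition sv_opp s : sv := [ffun i => omap negb (s i)].
(** The composition of covectors in an oriented matroid: the sign vector reached by a small step
    from a point of sign [s] in a direction of sign [t]. *)
Definition sv_comp s t : sv := [ffun i => if s i is None then t i else s i].
Definition sv_le t s : bool := [forall i, (t i == None) || (t i == s i)].
Definition sv_zero s : {set I} := [set i | s i == None].

Lemma sv_leP t s : reflect (forall i, t i = None \/ t i = s i) (sv_le t s).
Proof.
apply: (iffP forallP) => h i; have := h i.
  by move=> /orP[]/eqP; [left|right].
by move=> [] ->; rewrite eqxx ?orbT.
Qed.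

Lemma sv_oppK : involutive sv_opp.
Proof. by move=> s; apply/ffunP => i; rewrite !ffunE; case: (s i) => //= -[]. Qed.

Lemma sv_zero_opp s : sv_zero (sv_opp s) = sv_zero s.
Proof. by apply/finset.setP => i; rewrite !inE ffunE; case: (s i). Qed.

Lemma sv_zero0 : sv_zero sv0 = finset.setT.
Proof. by apply/finset.setP => i; rewrite !inE ffunE. Qed.

Lemma sv_zeroT s : sv_zero s = finset.setT -> s = sv0.
Proof.
move=> /finset.setP sT; apply/ffunP => i; rewrite ffunE; apply/eqP.
by have := sT i; rewrite !inE.
Qed.

Lemma sv_neq0P s : s != sv0 -> exists i, s i != None.
Proof.
move=> s0; apply/existsP; apply: contraR s0 => /existsPn h.
by apply/eqP/ffunP => i; rewrite ffunE; apply/eqP; have := h i; rewrite negbK.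
Qed.

Lemma sv_le_refl s : sv_le s s.
Proof. by apply/sv_leP; right. Qed.

Lemma sv_le_trans s t r : sv_le s t -> sv_le t r -> sv_le s r.
Proof.
move=> /sv_leP st /sv_leP tr; apply/sv_leP => i.
by have [|->] := st i; [left|exact: tr].
Qed.

Lemma sv_le_anti s t : sv_le s t -> sv_le t s -> s = t.
Proof.
move=> /sv_leP st /sv_leP ts; apply/ffunP => i.
by have [sN|//] := st i; have [tN|->//] := ts i; rewrite sN tN.
Qed.

Lemma sv_le_opp s t : sv_le (sv_opp s) (sv_opp t) = sv_le s t.
Proof.
wlog suff h : s t / sv_le s t -> sv_le (sv_opp s) (sv_opp t).
  by apply/idP/idP => [/h|/h//]; rewrite !sv_oppK.
move=> /sv_leP st; apply/sv_leP => i; rewrite !ffunE.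
by have [->|->] := st i; [left|right].
Qed.

Lemma sv_le_zero s t : sv_le s t -> sv_zero t \subset sv_zero s.
Proof.
move=> /sv_leP st; apply/fintype.subsetP => i; rewrite !inE => /eqP ti.
by have [->|->] := st i; rewrite ?ti.
Qed.

Lemma sv_le_zero_eq s t : sv_le s t -> sv_zero s = sv_zero t -> s = t.
Proof.
move=> /sv_leP st /finset.setP z; apply/ffunP => i; have := z i; rewrite !inE.
by have [->|//] := st i; rewrite eqxx => /esym/eqP ->.
Qed.

(** A nonzero entry of [s] would be equal both to an entry of [t] and to its opposite. *)
Lemma sv_le_opp_eq0 s t : sv_le s t -> sv_le s (sv_opp t) -> s = sv0.
Proof.
move=> /sv_leP st /sv_leP sNt; apply/ffunP => i; rewrite ffunE.
have [//|si] := st i; have [//|] := sNt i.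
by rewrite ffunE -si; case: (s i) => //= -[].
Qed.

Lemma sv_comp_full s t : sv_zero s = finset.set0 -> sv_comp s t = s.
Proof.
move=> /finset.setP z; apply/ffunP => i; rewrite ffunE; have := z i; rewrite !inE.
by case: (s i).
Qed.

Lemma sv_comp_le s t : sv_le s t -> sv_comp s t = t.
Proof.
move=> /sv_leP st; apply/ffunP => i; rewrite ffunE.
by have [->//|->] := st i; case: (t i).
Qed.

(* Among [s] and [- s] for [s != 0], exactly one has its first nonzero entry
   positive; "first" makes sense because [pick] only looks at the zero set. *)
Definition sv_pos s : bool :=
  if [pick i | i \notin sv_zero s] is Some i then s i == Some true else false.

Lemma sv_pos_opp s : s != sv0 -> sv_pos (sv_opp s) = ~~ sv_pos s.
Proof.
move=> s0; rewrite /sv_pos sv_zero_opp; case: pickP => [i|h].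
  by rewrite inE ffunE; case: (s i) => //= -[].
by have [i] := sv_neq0P s0; have := h i; rewrite inE /= => ->.
Qed.

(** The involution [sv_opp] exchanges the members of [D] that satisfy [sv_pos] with those that do
    not. *)
Lemma card_sv_pos (D : {set sv}) : sv0 \notin D ->
  (forall s, s \in D -> sv_opp s \in D) ->
  #|D| = (2 * #|[set s in D | sv_pos s]|)%N.
Proof.
move=> D0 DN; rewrite mul2n -addnn -(cardsID [set s | sv_pos s] D); congr addn.
  by apply: eq_card => s; rewrite !inE.
rewrite -(card_imset [set s in D | sv_pos s] (can_inj sv_oppK)).
apply: eq_card => s; apply/idP/imsetP => [|[t]]; rewrite !inE.
  move=> /andP[sp sD]; have s0 : s != sv0 by apply: contraNneq D0 => <-.
  by exists (sv_opp s); rewrite ?sv_oppK// inE DN//= sv_pos_opp.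
move=> /andP[tD tp] ->; have t0 : t != sv0 by apply: contraNneq D0 => <-.
by rewrite sv_pos_opp// negbK tp DN.
Qed.

End SignVector.
Arguments sv0 {I}.
Arguments sv_opp {I}.
Arguments sv_le {I}.

(** * Cells *)

Section Cell.
Context (R : realType) (n : nat) (I : finType) (a : I -> 'cV[R]_n.+1).
Local Notation P := (proj_space R n.+1).
Local Notation sv := {ffun I -> option bool}.
Implicit Types v w : 'rV[R]_n.+1.

Definition ev i v : R := (v *m a i) 0 0.

Lemma evD i v w : ev i (v + w) = ev i v + ev i w.
Proof. by rewrite /ev mulmxDl mxE. Qed.

Lemma evZ i c v : ev i (c *: v) = c * ev i v.
Proof. by rewrite /ev -scalemxAl mxE. Qed.

Lemma evN i v : ev i (- v) = - ev i v.
Proof. by rewrite -scaleN1r evZ mulN1r. Qed.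

Lemma ev_eq0 i v : ev i v = 0 <-> v *m a i = 0.
Proof.
split=> [h|]; last by rewrite /ev => ->; rewrite mxE.
by apply/matrixP => x y; rewrite !ord1 [RHS]mxE.
Qed.

Definition svec v : sv := [ffun i => sign (ev i v)].

Lemma svec0 : svec 0 = sv0.
Proof. by apply/ffunP => i; rewrite !ffunE /ev mul0mx mxE sign0. Qed.

Lemma svecN v : svec (- v) = sv_opp (svec v).
Proof. by apply/ffunP => i; rewrite !ffunE evN signN. Qed.

Lemma svec_pZ c v : 0 < c -> svec (c *: v) = svec v.
Proof. by move=> c0; apply/ffunP => i; rewrite !ffunE evZ sign_pM. Qed.

Lemma svecZ c v : c != 0 ->
  svec (c *: v) = svec v \/ svec (c *: v) = sv_opp (svec v).
Proof.
rewrite neq_lt => /orP[c0|c0]; [right|by left; rewrite svec_pZ].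
by rewrite -[c]opprK scaleNr svecN svec_pZ// oppr_gt0.
Qed.

Lemma mem_sv_zero v i : (i \in sv_zero (svec v)) = (ev i v == 0).
Proof. by rewrite inE ffunE sign_eq0. Qed.

Lemma svec_near v w :
  \forall t \near 0^'+, svec (v + t *: w) = sv_comp (svec v) (svec w).
Proof.
have : \forall t \near 0^'+, forall i, sign (ev i v + t * ev i w) =
    if ev i v == 0 then sign (ev i w) else sign (ev i v).
  by apply: filter_forall => i; exact: sign_near.
move=> h; near=> t; apply/ffunP => i; rewrite !ffunE evD evZ.
have -> : sign (ev i v + t * ev i w) =
    if ev i v == 0 then sign (ev i w) else sign (ev i v).
  by move: i; near: t.
by rewrite -sign_eq0; case: (sign _).
Unshelve. all: by end_near.
Qed.

Lemma open_sv_ge (s : sv) : open [set v | sv_le s (svec v)].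
Proof.
have -> : [set v | sv_le s (svec v)] =
    ~` \bigcup_(i in [set: I]) ~` [set v | s i = None \/ sign (ev i v) = s i].
  rewrite setC_bigcup; apply/seteqP; split=> v /=.
    move=> /sv_leP h i _; rewrite setCK /=.
    by have [|->] := h i; [left|rewrite ffunE; right].
  move=> h; apply/sv_leP => i; have := h i Logic.I; rewrite setCK /=.
  by rewrite ffunE => -[]; [left|right].
rewrite openC; apply: closed_bigcup => [|i _]; first exact: finite_finset.
apply: open_closedC.
apply: (@open_comp _ _ (ev i) [set x | s i = None \/ sign x = s i]).
  by move=> v _; exact: linear_form_continuous.
exact: open_sign.
Qed.

Lemma closed_sv_le (s : sv) : closed [set v | sv_le (svec v) s].
Proof.
have -> : [set v | sv_le (svec v) s] =
    \bigcap_(i in [set: I]) [set v | sign (ev i v) = None \/ sign (ev i v) = s i].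
  apply/seteqP; split=> v /=.
    by move=> /sv_leP h i _; have := h i; rewrite ffunE.
  by move=> h; apply/sv_leP => i; rewrite ffunE; exact: h.
apply: closed_bigI => i _.
apply: (@closed_comp _ _ (ev i) [set x | sign x = None \/ sign x = s i]).
  by move=> v _; exact: linear_form_continuous.
exact: closed_sign.
Qed.

Definition cell (s : sv) : set P := proj_pt @` [set v | v != 0 /\ svec v = s].

Lemma cell_svec v : v != 0 -> cell (svec v) (proj_pt v).
Proof. by exists v. Qed.

Lemma cell_opp s : cell (sv_opp s) = cell s.
Proof.
suff sub t : cell (sv_opp t) `<=` cell t.
  by apply/seteqP; split; [exact: sub|rewrite -{1}(sv_oppK s); exact: sub].
move=> _ [v [v0 vt] <-]; exists (- v).
  by split; rewrite ?oppr_eq0 // svecN vt sv_oppK.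
by rewrite -scaleN1r proj_ptZ// oppr_eq0 oner_neq0.
Qed.

Lemma cell_ptP s v : v != 0 ->
  cell s (proj_pt v) <-> svec v = s \/ svec v = sv_opp s.
Proof.
move=> v0; split.
  move=> [w [w0 <-]] /(eq_proj_pt w0 v0)[c c0 ->]; exact: svecZ.
move=> [<-|vs]; first exact: cell_svec.
by rewrite -(sv_oppK s) -vs cell_opp; exact: cell_svec.
Qed.

Lemma cell_eqP v w : v != 0 ->
  cell (svec v) = cell (svec w) <-> svec v = svec w \/ svec v = sv_opp (svec w).
Proof.
move=> v0; split=> [vw|[->|->]]; rewrite ?cell_opp//.
by apply/cell_ptP => //; rewrite -vw; exact: cell_svec.
Qed.

Lemma cell_connected s : s != sv0 -> connected (cell s).
Proof.
move=> s0; apply: proj_convex_connected => [v []//|v w t [v0 vs] [w0 ws] t01].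
have es : svec (v + t *: (w - v)) = s.
  rewrite -vs; apply/ffunP => i; rewrite !ffunE evD evZ evD evN.
  apply: sign_convex => //.
  by move/ffunP: vs => /(_ i); move/ffunP: ws => /(_ i); rewrite !ffunE => -> ->.
by split => //; apply: contraNneq s0 => h; rewrite -es h svec0.
Qed.

(** Both [s] and its opposite are allowed, so that the condition survives scaling by negative
    numbers and descends to projective space. *)
Let near_set (Q : sv -> sv -> bool) (s : sv) : set P :=
  proj_pt @` [set v | v != 0 /\
    ([set v | Q s (svec v)] `|` [set v | Q (sv_opp s) (svec v)]) v].

Let near_setZ (Q : sv -> sv -> bool) s :
  (forall t r, Q (sv_opp t) (sv_opp r) = Q t r) ->
  forall c v, c != 0 ->
  ([set v | Q s (svec v)] `|` [set v | Q (sv_opp s) (svec v)]) v ->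
  ([set v | Q s (svec v)] `|` [set v | Q (sv_opp s) (svec v)]) (c *: v).
Proof.
move=> QN c v c0 /=; have [->//|->] := svecZ v c0.
by move=> [h|h]; [right|left]; rewrite ?QN// -(sv_oppK s) QN.
Qed.

Let cell_up s := near_set sv_le s.
Let cell_down s := near_set (fun t r => sv_le r t) s.

Let open_cell_up s : open (cell_up s).
Proof.
apply: open_proj_set; first by apply: near_setZ => t r; rewrite sv_le_opp.
by apply: openU; exact: open_sv_ge.
Qed.

Let closed_cell_down s : closed (cell_down s).
Proof.
apply: closed_proj_set.
  exact: (@near_setZ (fun t r => sv_le r t) s (fun t r => sv_le_opp _ _)).
by apply: closedU; exact: closed_sv_le.
Qed.

(** The points below [svec w] up to sign form a closed set containing the cell of [w]. Conversely,
    if [svec v] lies below [svec x], then for [u] of sign [svec v] the points [u + t *: x] with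
    small positive [t] have sign [svec x] and tend to [u]. *)
Lemma cell_closureP v w : v != 0 -> w != 0 ->
  cell (svec v) `<=` closure (cell (svec w)) <->
  sv_le (svec v) (svec w) \/ sv_le (svec v) (sv_opp (svec w)).
Proof.
move=> v0 w0; split.
  move=> /(_ _ (cell_svec v0)) vw.
  have /(_ _ vw) : closure (cell (svec w)) `<=` cell_down (svec w).
    apply: subset_trans (@closed_cell_down (svec w)); apply: closureS.
    move=> _ [u [u0 uw] <-]; exists u => //; split => //=; left.
    by rewrite uw; exact: sv_le_refl.
  move=> [u [u0 uw]] /(eq_proj_pt u0 v0)[c c0 ->] /=.
  exact: (@near_setZ (fun t r => sv_le r t) _ (fun t r => sv_le_opp _ _) _ _ c0 uw).
suff lec x : sv_le (svec v) (svec x) -> cell (svec v) `<=` closure (cell (svec x)).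
  by move=> []; [exact: lec|rewrite -svecN => /lec; rewrite svecN cell_opp].
move=> vx _ [u [u0 uv] <-] W Wu.
have lin : u + t *: x @[t --> 0^'+] --> u.
  apply: cvg_within_filter; have := @line_continuous R n u x 0.
  by rewrite /continuous_at scale0r addr0.
have nbW : nbhs u (@nonzero R n.+1 `&` proj_pt @^-1` W).
  apply: filterI; last by apply: proj_pt_continuous => //; exact/mem_set.
  by apply: open_nbhs_nbhs; split => //; exact: open_nonzero.
have ne : \forall t \near 0^'+, (@nonzero R n.+1 `&` proj_pt @^-1` W) (u + t *: x).
  exact: lin nbW.
have [t [ut [ut0 Wut]]] : exists t, svec (u + t *: x) = svec x /\
    (@nonzero R n.+1 `&` proj_pt @^-1` W) (u + t *: x).
  near (0 : R)^'+ => t; exists t; split; last by near: t.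
  rewrite -[RHS](sv_comp_le vx) -uv; near: t; exact: svec_near.
by exists (proj_pt (u + t *: x)); split => //; exists (u + t *: x).
Unshelve. all: by end_near.
Qed.

(** Comparable sign vectors with the same zero set are equal, so within [X] the cell coincides both
    with the open set [cell_up] and with the closed set [cell_down]. Being connected and relatively
    clopen, it is a component. *)
Lemma cell_component (X : set P) (Z : {set I}) : Z != finset.setT ->
    (forall v, v != 0 -> X (proj_pt v) <-> sv_zero (svec v) = Z) ->
  forall v, v != 0 -> X (proj_pt v) ->
  connected_component X (proj_pt v) = cell (svec v).
Proof.
move=> ZT XE v v0 Xv; have vZ : sv_zero (svec v) = Z by apply/XE.
have s0 : svec v != sv0.
  apply: contraNneq ZT => v00; rewrite -vZ v00.
  by apply/eqP/finset.setP => i; rewrite !inE ffunE.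
have cellX : cell (svec v) `<=` X.
  by move=> _ [w [w0 wv] <-]; apply/XE => //; rewrite wv.
apply/seteqP; split; last first.
  by apply: connected_component_max => //; [exact: cell_svec|exact: cell_connected].
set CC := connected_component _ _.
have CCX : CC `<=` X by exact: connected_component_sub.
have upE q : X q -> cell_up (svec v) q -> cell (svec v) q.
  move=> Xq [w [w0 wv] qE]; rewrite -qE in Xq *; apply/cell_ptP => //.
  have wZ : sv_zero (svec w) = Z by apply/XE.
  case: wv => /= wv; [left|right]; apply/esym/sv_le_zero_eq => //.
    by rewrite vZ.
  by rewrite sv_zero_opp vZ.
have downE q : X q -> cell_down (svec v) q -> cell (svec v) q.
  move=> Xq [w [w0 wv] qE]; rewrite -qE in Xq *; apply/cell_ptP => //.
  have wZ : sv_zero (svec w) = Z by apply/XE.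
  case: wv => /= wv; [left|right]; apply/sv_le_zero_eq => //.
    by rewrite vZ.
  by rewrite sv_zero_opp vZ.
have cell_up_sub : cell (svec v) `<=` cell_up (svec v).
  by move=> _ [w [w0 wv] <-]; exists w => //; split => //=; left; rewrite wv sv_le_refl.
have cell_down_sub : cell (svec v) `<=` cell_down (svec v).
  by move=> _ [w [w0 wv] <-]; exists w => //; split => //=; left; rewrite wv sv_le_refl.
suff <- : CC `&` cell (svec v) = CC by apply: subIsetr.
apply: (component_connected (A := X) (x := proj_pt v)).
- exists (proj_pt v); split; last exact: cell_svec.
  exact: connected_component_refl.
- exists (cell_up (svec v)); first exact: open_cell_up.
  apply/seteqP; split=> q [CCq qv]; split => //; first exact: cell_up_sub.
  by apply: upE => //; exact: CCX.
- exists (cell_down (svec v)); first exact: closed_cell_down.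
  apply/seteqP; split=> q [CCq qv]; split => //; first exact: cell_down_sub.
  by apply: downE => //; exact: CCX.
Qed.

Definition covector (s : sv) : bool := `[< exists v, svec v = s >].

Lemma covectorP s : reflect (exists v, svec v = s) (covector s).
Proof. exact: asboolP. Qed.

Lemma covector_svec v : covector (svec v).
Proof. by apply/covectorP; exists v. Qed.

Lemma covector_opp s : covector s -> covector (sv_opp s).
Proof. by move=> /covectorP[v <-]; rewrite -svecN covector_svec. Qed.

Lemma components_cells (X : set P) (Z : {set I}) : Z != finset.setT ->
    (forall v, v != 0 -> X (proj_pt v) <-> sv_zero (svec v) = Z) ->
  components X = cell @` [set` [set s | covector s & sv_zero s == Z]%SET].
Proof.
move=> ZT XE; apply/seteqP; split=> [_ [q Xq <-]|_ [s + <-]].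
  have [v v0 qE] := proj_ptP q; rewrite -qE in Xq *.
  exists (svec v); last by rewrite (cell_component ZT XE).
  by rewrite /= inE covector_svec; apply/eqP/XE.
rewrite /= inE => /andP[/covectorP[v vs] /eqP sZ].
have v0 : v != 0.
  apply: contraNneq ZT => v0; rewrite -sZ -vs v0 svec0.
  by apply/eqP/finset.setP => i; rewrite !inE ffunE.
have Xv : X (proj_pt v) by apply/XE => //; rewrite vs.
by exists (proj_pt v) => //; rewrite (cell_component ZT XE)// vs.
Qed.

(** Each cell comes from exactly two opposite sign vectors, and [sv_pos] selects one of them. *)
Lemma card_cells (D : {set sv}) : sv0 \notin D ->
    {in D, forall s, covector s} -> (forall s, s \in D -> sv_opp s \in D) ->
  #|D| = (2 * ncard (cell @` [set` D]))%N.
Proof.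
move=> D0 Dcov DN; rewrite card_sv_pos//; congr (2 * _)%N.
set Dp := [set s in D | sv_pos s]%SET.
have -> : cell @` [set` D] = [set` [fset cell s | s in Dp]%fset].
  apply/seteqP; split=> [_ [s /= sD <-]|_ /= /imfsetP[s /= sD ->]]; last first.
    by move: sD; rewrite inE => /andP[sD _]; exists s.
  have s0 : s != sv0 by apply: contraNneq D0 => <-.
  apply/imfsetP; have [sp|sp] := boolP (sv_pos s).
    by exists s => //=; rewrite inE sD.
  by exists (sv_opp s); rewrite ?cell_opp//= inE DN//= sv_pos_opp.
rewrite /ncard set_fsetK card_in_imfset /=; first by rewrite cardE.
move=> s t; rewrite !inE => /andP[sD sp] /andP[tD tp] st.
have t0 : t != sv0 by apply: contraNneq D0 => <-.
have /covectorP[v vs] := Dcov _ sD; have /covectorP[w wt] := Dcov _ tD.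
have v0 : v != 0 by apply: contraNneq D0 => v0; rewrite -svec0 -v0 vs.
move: st; rewrite -vs -wt => /(cell_eqP _ v0); rewrite vs wt => -[//|tE].
by move: sp; rewrite tE sv_pos_opp// tp.
Qed.

End Cell.

(** * Walls of a chamber *)

Section Facet.
Context (R : realType) (n : nat) (I : finType) (a : I -> 'cV[R]_n.+1).
Local Notation sv := {ffun I -> option bool}.
Implicit Types (v w : 'rV[R]_n.+1) (s : sv).

Lemma col_neq0P (b : 'cV[R]_n.+1) : b != 0 -> exists v : 'rV_n.+1, (v *m b) 0 0 != 0.
Proof.
move=> /cV0Pn[i bi]; exists (delta_mx 0 i).
by rewrite -rowE mxE.
Qed.

(** Induction on the number of [b j] vanishing at [v]: a small step off one of these kernels
    preserves all nonzero signs and removes at least one zero. *)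
Lemma avoid_hyperplanes (J : finType) (b : J -> 'cV[R]_n.+1) v :
    (forall j, b j != 0) -> sv_zero (svec a v) = finset.set0 ->
  exists2 u, svec a u = svec a v & forall j, ev b j u != 0.
Proof.
move=> b0; have [m] := ubnP #|sv_zero (svec b v)|.
elim: m v => // m IH v; rewrite ltnS => vm vfull.
have [/eqP z0|/finset.set0Pn[j jz]] := boolP (sv_zero (svec b v) == finset.set0).
  by exists v => // j; rewrite -mem_sv_zero z0 inE.
have [d dj] := col_neq0P (b0 j).
have [t [ta tb]] : exists t, svec a (v + t *: d) = svec a v /\
    svec b (v + t *: d) = sv_comp (svec b v) (svec b d).
  near (0 : R)^'+ => t; exists t; split; last by near: t; exact: svec_near.
  rewrite -[RHS](sv_comp_full (svec a d) vfull).
  by near: t; exact: svec_near.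
have [||u ua ub] := IH (v + t *: d).
- apply: leq_trans vm; apply: proper_card; apply/fintype.properP; split.
    by rewrite tb; apply/fintype.subsetP => i; rewrite !inE !ffunE; case: (sign _).
  exists j => //; move: jz; rewrite tb !inE !ffunE => /eqP ->.
  by rewrite sign_eq0.
- by rewrite ta.
- by exists u => //; rewrite ua.
Unshelve. all: by end_near.
Qed.

Hypothesis a_inj : forall i j c, i != j -> a i != c *: a j.

(* The ray from a generic interior point [u] in the direction [w] leaves the
   cone through a single wall. *)
Lemma exit_wall u w j : (forall i, 0 < ev a i u) -> ev a j w < 0 ->
  exists k x, [/\ ev a k w < 0, ev a k x = 0 & forall i, i != k -> 0 < ev a i x].
Proof.
move=> u_pos wj.
(* The covector [b p] vanishes at a starting point exactly when the ray in direction [w] meets the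
   planes [p.1] and [p.2] at the same time. It is nonzero because no two covectors are
   proportional. *)
pose neg_pair (p : I * I) := [&& p.1 != p.2, ev a p.1 w < 0 & ev a p.2 w < 0].
pose b (p : {p | neg_pair p}) :=
  ev a (val p).2 w *: a (val p).1 - ev a (val p).1 w *: a (val p).2.
have b0 p : b p != 0.
  have /and3P[ik wi wk] := valP p; rewrite /b subr_eq0.
  apply: contraNneq (a_inj ((ev a (val p).2 w)^-1 * ev a (val p).1 w) ik) => h.
  by rewrite -scalerA -h scalerK// lt_eqF.
have ufull : sv_zero (svec a u) = finset.set0.
  by apply/finset.setP => i; rewrite mem_sv_zero inE gt_eqF.
have [x xu xb] := avoid_hyperplanes b0 ufull.
have x_pos i : 0 < ev a i x.
  move/ffunP: xu => /(_ i); rewrite !ffunE.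
  by rewrite -sign_eqT => ->; rewrite sign_eqT.
(* This is the time at which the ray from [x] reaches plane [i]; the wall crossed is the one with
   the least time. *)
pose ratio i := ev a i x / - ev a i w.
have [k wk kmin] :=
  @Order.TotalTheory.arg_minP _ _ _ j (fun i => ev a i w < 0) ratio wj.
have kw0 : 0 < - ev a k w by rewrite oppr_gt0.
have r0 : 0 < ratio k by rewrite divr_gt0.
exists k, (x + ratio k *: w); split => //.
  by rewrite evD evZ /ratio invrN mulrN mulNr divfK ?subrr// lt_eqF.
move=> i ik; rewrite evD evZ; have [wi|wi] := leP 0 (ev a i w).
  by rewrite ltr_wpDr// mulr_ge0// ltW.
suff lt : ratio k < ratio i.
  by rewrite -(opprK (ev a i w)) mulrN subr_gt0 -ltr_pdivlMr// oppr_gt0.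
(* Equal times for [i] and [k] would contradict the choice of [x] off the kernel of [b (i, k)]. *)
rewrite lt_neqAle kmin// andbT; apply/negP => /eqP rE.
have pik : neg_pair (i, k) by rewrite /neg_pair /= ik wi wk.
have /eqP := xb (exist _ (i, k) pik); apply.
have entB (A B : 'M[R]_1) : (A - B) 0 0 = A 0 0 - B 0 0 by rewrite !mxE.
have entZ c (A : 'M[R]_1) : (c *: A) 0 0 = c * A 0 0 by rewrite mxE.
rewrite /ev /b /= mulmxBr -!scalemxAr entB !entZ -![(_ *m _) 0 0]/(ev a _ _).
move: rE; rewrite /ratio => /eqP.
rewrite !invrN !mulrN eqr_opp eqr_div ?(ltr0_neq0 wi) ?(ltr0_neq0 wk)// => /eqP rE.
by rewrite mulrC [ev a i w * _]mulrC -rE subrr.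
Qed.
End Facet.

(** * The closed cone of a chamber and its walls *)

Section FacetOfChamber.
Context (R : realType) (n : nat) (I : finType) (a : I -> 'cV[R]_n.+1).
Hypothesis a_inj : forall i j c, i != j -> a i != c *: a j.
Hypothesis a_ess : forall v, svec a v = sv0 -> v = 0.
Local Notation sv := {ffun I -> option bool}.
Implicit Types (v w : 'rV[R]_n.+1) (s : sv).

(** Only a candidate: plane [k] bounds the chamber when some vector realizes this sign vector, which
    is what [facets] tests. *)
Definition wall s k : sv := [ffun i => if i == k then None else s i].
Definition facets s : {set I} := [set k | covector a (wall s k)].

Context (s : sv) (s_cov : covector a s) (s_full : sv_zero s = finset.set0).

Lemma wall_le k : sv_le (wall s k) s.
Proof. by apply/sv_leP => i; rewrite ffunE; case: ifP; [left|right]. Qed.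

Lemma sv_zero_wall k : sv_zero (wall s k) = [set k]%SET.
Proof.
apply/finset.setP => i; rewrite !inE ffunE; case: (i =P k) => // _.
by have /finset.setP/(_ i) := s_full; rewrite !inE.
Qed.

(** Covectors are reoriented so that the chamber is the cone on which every [pev i] is positive. *)
Let sg i : R := if s i == Some true then 1 else -1.
Let pev i v : R := sg i * ev a i v.

Let pev_eq0 i v : (pev i v == 0) = (ev a i v == 0).
Proof. by rewrite /pev /sg mulf_eq0; case: ifP => _; rewrite ?oppr_eq0 oner_eq0. Qed.

Let pev_gt0 i v : (0 < pev i v) = (sign (ev a i v) == s i).
Proof.
have /finset.setP/(_ i) := s_full; rewrite !inE /pev /sg.
case: (s i) => // -[] _; rewrite ?mul1r ?sign_eqT//=.
by rewrite mulN1r oppr_gt0 sign_eqF.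
Qed.

Let svec_le v : sv_le (svec a v) s <-> forall i, 0 <= pev i v.
Proof.
split=> [/sv_leP h i|h].
  have := h i; rewrite ffunE le0r pev_eq0 pev_gt0 -sign_eq0.
  by move=> [] ->; rewrite eqxx ?orbT.
apply/sv_leP => i; have := h i; rewrite ffunE le0r pev_eq0 pev_gt0 -sign_eq0.
by move=> /orP[]/eqP; [left|right].
Qed.

Let pevE i v : pev i v = ev (fun i => sg i *: a i) i v.
Proof. by rewrite /ev -scalemxAr mxE. Qed.

(** The walls alone cut out the closed cone: a ray from inside the chamber in direction [w] leaves
    through a wall, whose inequality [w] violates. *)
Let wall_covector w j : pev j w < 0 -> exists2 k, k \in facets s & pev k w < 0.
Proof.
move=> wj; have /covectorP[u us] := s_cov.
have sg0 i : sg i != 0 by rewrite /sg; case: ifP => _; rewrite ?oppr_eq0 oner_eq0.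
have b_inj i k c : i != k -> sg i *: a i != c *: (sg k *: a k).
  move=> ik; apply: contraNneq (a_inj ((sg i)^-1 * (c * sg k)) ik) => h.
  by rewrite -!scalerA -h scalerK.
have u_pos i : 0 < ev (fun i => sg i *: a i) i u.
  by rewrite -pevE pev_gt0 -us ffunE.
rewrite pevE in wj.
have [k [x [wk xk x_pos]]] := exit_wall b_inj u_pos wj.
exists k; rewrite ?pevE// inE; apply/covectorP; exists x.
apply/ffunP => i; rewrite !ffunE; case: (eqVneq i k) => [->|ik].
  by apply/eqP; rewrite sign_eq0 -pev_eq0 pevE xk.
by apply/eqP; rewrite -pev_gt0 pevE x_pos.
Qed.

(** Both [w] and [- w] satisfy all wall inequalities, hence all inequalities of the cone, so every
    covector vanishes at [w]. *)
Lemma facets_span w : (forall k, k \in facets s -> ev a k w = 0) -> w = 0.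
Proof.
have ge0 v : (forall k, k \in facets s -> ev a k v = 0) -> forall i, 0 <= pev i v.
  move=> h i; rewrite leNgt; apply/negP => /wall_covector[k kF].
  by rewrite /pev h// mulr0 ltxx.
move=> h; apply: a_ess; apply/ffunP => i; rewrite !ffunE; apply/eqP.
rewrite sign_eq0 -pev_eq0 eq_le ge0// andbT.
have -> : pev i w = - pev i (- w) by rewrite /pev evN mulrN opprK.
by rewrite oppr_le0 ge0// => k kF; rewrite evN h// oppr0.
Qed.

(** At most [n] linear forms on a space of dimension [n.+1] have a common nonzero zero, against
    [facets_span]. *)
Lemma card_facets_ge : (n < #|facets s|)%N.
Proof.
rewrite ltnNge; apply/negP => Fn.
pose M : 'M[R]_(n.+1, #|facets s|) := \matrix_(i, k) a (enum_val k) i 0.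
have : kermx M != 0.
  rewrite kermx_eq0 /row_free neq_ltn.
  by rewrite (leq_ltn_trans (rank_leq_col M))// ltnS.
rewrite -nz_row_eq0 => /eqP; apply; apply: facets_span => k kF.
have := nz_row_sub (kermx M); move: (nz_row _) => w /sub_kermxP wM.
move/rowP: wM => /(_ (enum_rank_in kF k)); rewrite /ev mxE !mxE => wk.
by rewrite -[RHS]wk; apply: eq_bigr => i _; rewrite mxE enum_rankK_in.
Qed.

(* When the walls are as few as possible, their covectors form a basis whose
   dual basis generates the cone, so a face is determined by the set of
   coordinates that do not vanish on it. *)
Lemma simplicial_cone : #|facets s| = n.+1 ->
  exists x : {set 'I_n.+1} -> 'rV[R]_n.+1,
    [/\ forall S, sv_le (svec a (x S)) s,
        forall v, sv_le (svec a v) s -> exists S, svec a v = svec a (x S) &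
        forall S T : {set 'I_n.+1},
          (S \subset T) = sv_le (svec a (x S)) (svec a (x T))].
Proof.
move=> Fn; pose f (k : 'I_n.+1) := enum_val (cast_ord (esym Fn) k).
have fF k : f k \in facets s by exact: enum_valP.
have f_surj k : k \in facets s -> exists i, k = f i.
  move=> kF; exists (cast_ord Fn (enum_rank_in kF k)).
  by rewrite /f cast_ordK enum_rankK_in.
pose M : 'M[R]_n.+1 := \matrix_(i, k) (sg (f k) * a (f k) i 0).
have ME v k : (v *m M) 0 k = pev (f k) v.
  rewrite /pev /ev !mxE mulr_sumr; apply: eq_bigr => i _.
  by rewrite !mxE mulrCA.
have Mu : M \in unitmx.
  rewrite -row_free_unit -kermx_eq0 -nz_row_eq0; apply/eqP.
  apply: facets_span => _ /f_surj[k ->]; apply/eqP.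
  rewrite -pev_eq0 -ME.
  have := nz_row_sub (kermx M); move: (nz_row _) => w /sub_kermxP ->.
  by rewrite mxE.
(* The dual basis of the wall covectors; its members span the extreme rays of the cone. *)
pose e k : 'rV[R]_n.+1 := row k (invmx M).
have eM k j : pev (f j) (e k) = (k == j)%:R.
  by rewrite -ME /e -row_mul mulVmx// !mxE.
have e_ge0 k i : 0 <= pev i (e k).
  rewrite leNgt; apply/negP => /wall_covector[_ /f_surj[j ->]].
  by rewrite eM ltNge ler0n.
have pevD v i : pev i v = \sum_k pev (f k) v * pev i (e k).
  rewrite {1}/pev /ev -[in LHS](mulmxK Mu v) (mulmx_sum_row (v *m M)).
  rewrite mulmx_suml summxE mulr_sumr.
  by apply: eq_bigr => k _; rewrite -scalemxAl mxE ME mulrCA.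
(* A relative interior point of the face generated by the rays in [S]. *)
pose x (S : {set 'I_n.+1}) := \sum_(k in S) e k.
have xf S k : pev (f k) (x S) = (k \in S)%:R.
  rewrite /pev /ev /x mulmx_suml summxE mulr_sumr.
  transitivity (\sum_(j in S) (j == k)%:R : R).
    by apply: eq_bigr => j _; rewrite -eM.
  have [kS|kS] := boolP (k \in S).
    rewrite (bigD1 k)//= eqxx big1 ?addr0// => j /andP[_ /negPf ->//].
  by rewrite big1 // => j jS; case: eqVneq => // jk; rewrite -jk jS in kS.
have x_le S : sv_le (svec a (x S)) s.
  by apply/svec_le => i; rewrite pevD sumr_ge0// => k _; rewrite mulr_ge0// xf ler0n.
(* [ev a i v] is a combination with nonnegative coefficients of the nonnegative
   coordinates of [v], so it vanishes iff each of its terms does. *)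
have zeroP v i : sv_le (svec a v) s -> (ev a i v == 0) =
    [forall k, (0 < pev (f k) v) ==> (pev i (e k) == 0)].
  move=> /svec_le v_ge0; rewrite -pev_eq0 pevD psumr_eq0; last first.
    by move=> k _; rewrite mulr_ge0.
  apply/allP/forallP => h k.
    have := h k (mem_index_enum k); rewrite /= mulf_eq0 => /orP[/eqP ->|->].
      by rewrite ltxx.
    exact: implybT.
  move=> _ /=; rewrite mulf_eq0; have := h k.
  by rewrite lt0r v_ge0 andbT; case: (_ == 0).
have leP v w : sv_le (svec a v) s -> sv_le (svec a w) s ->
    sv_le (svec a v) (svec a w) = [forall k, (0 < pev (f k) v) ==> (0 < pev (f k) w)].
  move=> vs ws; apply/idP/forallP => [vw k|h].
    have /fintype.subsetP/(_ (f k)) := sv_le_zero vw.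
    rewrite !mem_sv_zero -!pev_eq0 => vwk.
    apply/implyP; rewrite !lt0r => /andP[v0 _].
    by rewrite (contra vwk v0) //=; move/svec_le: ws; exact.
  (* If [w] vanishes on plane [i], so does every ray in its support, hence also every ray in the
     smaller support of [v]. *)
  apply/sv_leP => i; move/sv_leP: vs (vs) => /(_ i) [->|vi vs]; first by left.
  have [wN|wi] := (sv_leP _ _ ws) i; last by right; rewrite vi wi.
  left; apply/eqP; rewrite ffunE sign_eq0 zeroP//.
  apply/forallP => k; apply/implyP => vk.
  have : ev a i w == 0 by rewrite -sign_eq0; apply/eqP; rewrite -wN ffunE.
  rewrite zeroP// => /forallP/(_ k)/implyP; apply.
  by have /implyP := h k; apply.
exists x; split=> // [v vs|S T].
  (* The support of [v] in the dual basis determines its sign vector. *)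
  exists [set k | 0 < pev (f k) v]%SET; apply: sv_le_anti; rewrite leP//.
    by apply/forallP => k; apply/implyP; rewrite xf inE => ->; rewrite ltr01.
  apply/forallP => k; apply/implyP; rewrite xf inE; case: (0 < pev (f k) v) => //.
  by rewrite ltxx.
rewrite leP//; apply/fintype.subsetP/forallP => h k; rewrite ?xf.
  by have := h k; case: (k \in S) => [/(_ isT) ->|_]; rewrite ?ltr01 ?implybT// ltxx.
by move=> kS; have := h k; rewrite !xf kS ltr01 /=; case: (k \in T) => //; rewrite ltxx.
Qed.

End FacetOfChamber.

(** * The face poset *)

Section FaceLattice.
Context (R : realType) (n : nat) (I : finType) (a : I -> 'cV[R]_n.+1).
Local Notation P := (proj_space R n.+1).
Local Notation sv := {ffun I -> option bool}.
Hypothesis a_neq0 : forall i, a i != 0.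
Hypothesis ker_inj : injective (fun i => proj_ker (a i)).
Hypothesis a_ess : forall v, svec a v = sv0 -> v = 0.
Let A : set (set P) := [set proj_ker (a i) | i in [set: I]].
Implicit Types (v w : 'rV[R]_n.+1) (s t : sv).

Lemma proj_ker_svec v i : v != 0 ->
  proj_ker (a i) (proj_pt v) <-> i \in sv_zero (svec a v).
Proof.
move=> v0; rewrite mem_sv_zero.
by split => [/(proj_kerP _ v0)/ev_eq0/eqP//|/eqP/ev_eq0/(proj_kerP _ v0)].
Qed.

Lemma covectors_independent i j c : i != j -> a i != c *: a j.
Proof.
apply: contra_neq => aij; apply: ker_inj.
have c0 : c != 0 by apply: contra_eq_neq aij => ->; rewrite scale0r.
apply/seteqP; split=> _ [u /= ua <-]; exists u => //=.
  by rewrite -[a j](scalerK c0) -aij -scalemxAr ua scaler0.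
by rewrite aij -scalemxAr ua scaler0.
Qed.

Lemma svec_neq0 v : (svec a v != sv0) = (v != 0).
Proof.
by congr negb; apply/eqP/eqP => [/a_ess//|->]; exact: svec0.
Qed.

Lemma exists_full_covector : exists v, sv_zero (svec a v) = finset.set0.
Proof.
(* With an empty family there is no sign to preserve, so the zero vector is a legitimate starting
   point. *)
pose c (i : void) : 'cV[R]_n.+1 := of_void _ i.
have [|u _ ua] := @avoid_hyperplanes R n _ c _ a 0 a_neq0.
  by apply/finset.setP => -[].
by exists u; apply/finset.setP => i; rewrite mem_sv_zero inE (negPf (ua i)).
Qed.

(** Some chamber exists, and its walls are already more than [n] planes. *)
Lemma card_planes_gt : (n < #|I|)%N.
Proof.
have [v vfull] := exists_full_covector.
apply: leq_trans (max_card _).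
exact: (card_facets_ge covectors_independent a_ess (covector_svec a v) vfull).
Qed.

Definition covectors (Z : {set I}) : {set sv} :=
  [set s | covector a s & sv_zero s == Z]%SET.

Lemma chambersE : chambers [set: P] A = cell a @` [set` covectors finset.set0].
Proof.
apply: components_cells => [|v v0]; last first.
  split=> [[_ h]|h].
    apply/finset.setP => i; rewrite finset.in_set0.
    apply/negP => /(proj_ker_svec _ v0) iv.
    by apply: h; exists (proj_ker (a i)) => //; exists i.
  split=> // -[_ [i _ <-]] /(proj_ker_svec _ v0).
  by rewrite h inE.
rewrite eq_sym -finset.cards_eq0 finset.cardsT -lt0n.
exact: leq_ltn_trans card_planes_gt.
Qed.

(** Shared by the two-dimensional cells in a plane and the chambers of the restriction to it.
    Positivity of [n] ensures that there is a second plane. *)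
Lemma wall_locus (X : set P) i : (0 < n)%N ->
    (forall v, v != 0 ->
      X (proj_pt v) <-> proj_ker (a i) (proj_pt v) /\
        forall j, j != i -> ~ proj_ker (a j) (proj_pt v)) ->
  components X = cell a @` [set` covectors [set i]%SET].
Proof.
move=> n0 XE; apply: components_cells => [|v v0].
  apply/eqP => iT; have := card_planes_gt.
  by rewrite -finset.cardsT -iT finset.cards1 ltnS leqNgt n0.
rewrite XE//; split=> [[/(proj_ker_svec _ v0) vi vj]|h].
  apply/finset.setP => j; rewrite finset.in_set1; case: (eqVneq j i) => [->//|ji].
  by apply/negP => /(proj_ker_svec _ v0); exact: vj.
split=> [|j ji]; first by apply/(proj_ker_svec _ v0); rewrite h finset.in_set1.
by move=> /(proj_ker_svec _ v0); rewrite h finset.in_set1 (negPf ji).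
Qed.

Lemma two_cellE i : (0 < n)%N ->
  components (proj_ker (a i) `\` \bigcup_(H in A `\ proj_ker (a i)) H) =
  cell a @` [set` covectors [set i]%SET].
Proof.
move=> n0; apply: wall_locus => // v v0; split=> -[vi vj]; split=> //.
  move=> j ji vj'; apply: vj; exists (proj_ker (a j)) => //.
  by split; [exists j|move=> /ker_inj /eqP; rewrite (negPf ji)].
move=> [_ [[j _ <-] ji]]; apply: vj; apply/eqP => jE.
by apply: ji; rewrite /= jE.
Qed.

(** Only the union of the traces matters, so planes that cut the same line in plane [i] cause no
    discrepancy with [two_cellE]. *)
Lemma restriction_chambersE i : (0 < n)%N ->
  chambers (proj_ker (a i)) (restriction A (proj_ker (a i))) =
  cell a @` [set` covectors [set i]%SET].
Proof.
move=> n0; apply: wall_locus => // v v0; split=> -[vi vj]; split=> //.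
  move=> j ji vj'; apply: vj; exists (proj_ker (a i) `&` proj_ker (a j)) => //.
  exists (proj_ker (a j)) => //.
  by split; [exists j|move=> /ker_inj /eqP; rewrite (negPf ji)].
move=> [_ [_ [[j _ <-] ji] <-] [_]]; apply: vj; apply/eqP => jE.
by apply: ji; rewrite /= jE.
Qed.

Lemma cellsE : cells A = [set cell a (svec a v) | v in @nonzero R n.+1].
Proof.
have XE (B : set (set P)) v : B `<=` A -> v != 0 ->
    ((\bigcap_(H in B) H) `\` \bigcup_(H in A `\` B) H) (proj_pt v) <->
    sv_zero (svec a v) = [set i | `[< B (proj_ker (a i)) >]]%SET.
  move=> BA v0; split=> [[vB vN]|h].
    apply/finset.setP => i; rewrite [in RHS]inE.
    apply/idP/asboolP => [/(proj_ker_svec _ v0) vi|Bi]; last first.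
      by apply/(proj_ker_svec _ v0); exact: vB.
    apply: contrapT => nBi; apply: vN; exists (proj_ker (a i)) => //.
    by split => //; exists i.
  have {}h i : proj_ker (a i) (proj_pt v) <-> B (proj_ker (a i)).
    split=> [/(proj_ker_svec _ v0)|Bi]; first by rewrite h inE => /asboolP.
    by apply/(proj_ker_svec _ v0); rewrite h inE; apply/asboolP.
  split=> [H BH|[H [AH nBH]]]; last by case: AH nBH => i _ <- + /h.
  by have [i _ HE] := BA _ BH; rewrite -HE in BH *; exact/h.
apply/seteqP; split=> [F [B BA]|_ [v v0 <-]].
  (* When [B] contains all the planes, its locus is empty because the arrangement is essential. *)
  have [ZT|ZT] := eqVneq [set i | `[< B (proj_ker (a i)) >]]%SET finset.setT.
    move=> [q Xq _]; have [v v0 qE] := proj_ptP q; rewrite -qE in Xq.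
    have := XE _ _ BA v0; rewrite ZT => /iffLR /(_ Xq) vT.
    suff : svec a v = sv0 by move/eqP; rewrite -[_ == _]negbK svec_neq0 v0.
    exact: sv_zeroT.
  rewrite (components_cells ZT (fun v => XE B v BA)).
  move=> [s + <-]; rewrite /= inE => /andP[/covectorP[v <-] /eqP sZ].
  exists v => //; rewrite /nonzero/= -svec_neq0; apply: contraNneq ZT => v00.
  by rewrite -sZ v00 sv_zero0.
pose B := [set H | A H /\ H (proj_pt v)]; have BA : B `<=` A by move=> H [].
have ZE : sv_zero (svec a v) = [set i | `[< B (proj_ker (a i)) >]]%SET.
  apply/finset.setP => i; rewrite [in RHS]inE.
  apply/idP/asboolP => [/(proj_ker_svec _ v0) vi|[_ /(proj_ker_svec _ v0)]//].
  by split=> //; exists i.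
exists B => //; rewrite (@components_cells R n I a _ (sv_zero (svec a v))).
- by exists (svec a v) => //=; rewrite inE covector_svec eqxx.
- by apply: contraTneq v0 => vT; rewrite -svec_neq0 negbK; apply/eqP/sv_zeroT.
- by move=> w w0; rewrite ZE; exact: XE.
Qed.

Section Chamber.
Context (s : sv) (s_cov : covector a s) (s_full : sv_zero s = finset.set0).

Lemma full_neq0 : s != sv0.
Proof.
apply/eqP => s0; have /card_gt0P[i _] := leq_ltn_trans (leq0n n) card_planes_gt.
by have := finset.in_set0 i; rewrite -s_full s0 inE ffunE.
Qed.

(** A face lies below [s] or below its opposite; in the second case [- v] represents the same cell
    and lies below [s]. *)
Lemma faces_chamberE :
  faces A (cell a s) =
    [set cell a (svec a v) | v in [set v | v != 0 /\ sv_le (svec a v) s]].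
Proof.
have [w ws] := covectorP _ _ s_cov.
have w0 : w != 0 by rewrite -svec_neq0 ws full_neq0.
rewrite /faces cellsE -ws; apply/seteqP; split=> F /=.
  move=> [[v v0 <-]] /(cell_closureP a v0 w0) [vs|]; first by exists v.
  rewrite -sv_le_opp sv_oppK -svecN => vs; exists (- v); rewrite ?oppr_eq0//.
  by rewrite svecN cell_opp.
move=> [v [v0 vs] <-]; split; first by exists v.
by apply/(cell_closureP a v0 w0); left.
Qed.

(** Among representatives in one closed cone the sign ambiguity of [cell_closureP] disappears, by
    [sv_le_opp_eq0]. *)
Lemma face_leP v w : v != 0 -> w != 0 ->
    sv_le (svec a v) s -> sv_le (svec a w) s ->
  cell a (svec a v) `<=` closure (cell a (svec a w)) <-> sv_le (svec a v) (svec a w).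
Proof.
move=> v0 w0 vs ws; split=> [/(cell_closureP a v0 w0)[//|vw]|vw]; last first.
  by apply/(cell_closureP a v0 w0); left.
move/eqP: v0; case; apply/a_ess/(sv_le_opp_eq0 vs)/(sv_le_trans vw).
by rewrite sv_le_opp.
Qed.

Lemma face_inj v w : v != 0 -> w != 0 ->
    sv_le (svec a v) s -> sv_le (svec a w) s ->
  cell a (svec a v) = cell a (svec a w) -> svec a v = svec a w.
Proof.
move=> v0 w0 vs ws vw; apply: sv_le_anti; apply/face_leP => //; rewrite vw;
  exact: subset_closure.
Qed.

End Chamber.
End FaceLattice.

(** * Tetrahedral chambers are those with four walls *)

Section Tetrahedron.
Context (R : realType) (I : finType) (a : I -> 'cV[R]_4).
Local Notation P := (proj_space R 4).
Local Notation sv := {ffun I -> option bool}.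
Hypothesis a_neq0 : forall i, a i != 0.
Hypothesis ker_inj : injective (fun i => proj_ker (a i)).
Hypothesis a_ess : forall v, svec a v = sv0 -> v = 0.
Let A : set (set P) := [set proj_ker (a i) | i in [set: I]].
Context (s : sv) (s_cov : covector a s) (s_full : sv_zero s = finset.set0).

Lemma facets_tetrahedral : #|facets a s| = 4 -> tetrahedral A (cell a s).
Proof.
have a_ind := covectors_independent a_neq0 ker_inj.
move=> F4.
have [x [x_le x_surj x_mono]] := simplicial_cone a_ind a_ess s_cov s_full F4.
(* The empty set of rays is the apex of the cone, which has no projective point; this is why only
   nonempty sets index faces. *)
have x0 : svec a (x finset.set0) = sv0.
  have [|S xS] := x_surj 0; first by rewrite svec0; apply/sv_leP; left; rewrite ffunE.
  apply: sv_le_anti; last by apply/sv_leP; left; rewrite ffunE.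
  by rewrite -(svec0 a) xS -x_mono finset.sub0set.
have x_neq0 S : (x S != 0) = (S != finset.set0).
  rewrite -(svec_neq0 a_ess); congr negb; apply/eqP/eqP => [xS|->//].
  by apply/eqP; rewrite -finset.subset0 x_mono xS x0 sv_le_refl.
exists (fun S => cell a (svec a (x S))); last first.
  move=> S T; rewrite -!x_neq0 x_mono => S0 T0.
  by rewrite (face_leP a_ess S0 T0 (x_le S) (x_le T)).
rewrite (faces_chamberE a_neq0 ker_inj a_ess s_cov s_full); split.
- by move=> S; rewrite /= -x_neq0 => S0; exists (x S).
- move=> S T /set_mem/= + /set_mem/=; rewrite -!x_neq0 => S0 T0.
  move=> /(face_inj a_ess S0 T0 (x_le S) (x_le T)) xST.
  by apply/eqP; rewrite finset.eqEsubset !x_mono xST sv_le_refl.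
- move=> _ [v [v0 vs] <-]; have [S vS] := x_surj v vs.
  exists S; last by rewrite vS.
  by rewrite /= -x_neq0 -(svec_neq0 a_ess) -vS (svec_neq0 a_ess).
Qed.

Lemma tetrahedral_facets : tetrahedral A (cell a s) -> (#|facets a s| <= 4)%N.
Proof.
move=> [phi [phi_fun phi_inj phi_surj] phi_mono].
have facesE := faces_chamberE a_neq0 ker_inj a_ess s_cov s_full.
rewrite facesE in phi_fun phi_surj.
pose face S v := [/\ v != 0, sv_le (svec a v) s & phi S = cell a (svec a v)].
have phiP (S : {set 'I_4}) : S != finset.set0 -> exists v, face S v.
  by move=> /phi_fun [v [v0 vs] vS]; exists v.
have faceP v : v != 0 -> sv_le (svec a v) s ->
    exists2 S, S != finset.set0 & face S v.
  move=> v0 vs.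
  by have [|S S0 SE] := phi_surj (cell a (svec a v)); [exists v|exists S].
have face_mono (S T : {set 'I_4}) v w :
    S != finset.set0 -> T != finset.set0 -> face S v -> face T w ->
    (S \subset T) = sv_le (svec a v) (svec a w).
  move=> S0 T0 [v0 vs Sv] [w0 ws Tw]; apply/idP/idP.
    by move=> /(phi_mono _ _ S0 T0); rewrite Sv Tw (face_leP a_ess v0 w0 vs ws).
  by move=> vw; apply/(phi_mono _ _ S0 T0); rewrite Sv Tw (face_leP a_ess v0 w0 vs ws).
have [u us] := covectorP _ _ s_cov.
have u0 : u != 0.
  by rewrite -(svec_neq0 a_ess) us (full_neq0 a_neq0 ker_inj a_ess s_full).
(* [T] corresponds to the chamber itself, the largest face, so it contains every set of vertices. *)
have [T T0 Tu] : exists2 T, T != finset.set0 & face T u.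
  by apply: faceP; rewrite // us sv_le_refl.
have TT (S : {set 'I_4}) : S \subset T.
  have [->|S0] := eqVneq S finset.set0; first exact: finset.sub0set.
  by have [v Sv] := phiP _ S0; rewrite (face_mono _ _ _ _ S0 T0 Sv Tu) us; case: Sv.
(* A wall is a coatom of the face lattice, hence the complement of a vertex. *)
have coatom k : k \in facets a s ->
    exists i v, svec a v = wall s k /\ face (~: [set i])%SET v.
  rewrite inE => /covectorP[v vk].
  have vs : sv_le (svec a v) s by rewrite vk wall_le.
  have v0 : v != 0.
    rewrite -(svec_neq0 a_ess); apply/eqP => v00.
    have := sv_zero_wall s_full k; rewrite -vk v00 sv_zero0 => zT.
    have := card_planes_gt a_neq0 ker_inj a_ess.
    by rewrite -finset.cardsT zT finset.cards1.
  have [S S0 Sv] := faceP _ v0 vs.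
  have [i iS] : exists i, i \notin S.
    apply/existsP; rewrite -negb_forall; apply/negP => /forallP ST.
    have : T \subset S by apply/fintype.subsetP => i _; exact: ST.
    rewrite (face_mono _ _ _ _ T0 S0 Tu Sv) us vk => /sv_le_zero.
    by rewrite (sv_zero_wall s_full) s_full finset.sub1set finset.in_set0.
  have iS0 : (~: [set i])%SET != finset.set0.
    by rewrite -finset.cards_eq0 cardsC1 card_ord.
  have [w iw] := phiP _ iS0; exists i, w; split=> //.
  have := face_mono _ _ _ _ S0 iS0 Sv iw.
  rewrite finset.subsetC finset.sub1set finset.inE iS => /esym vw.
  have := face_mono _ _ _ _ T0 iS0 Tu iw.
  have /fintype.subsetP/(_ i (finset.set11 i)) iT := TT [set i]%SET.
  have -> : (T \subset ~: [set i])%SET = false.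
    by apply/negP => /fintype.subsetP/(_ _ iT); rewrite !inE eqxx.
  rewrite us => /esym/negbT sw; rewrite -vk; apply/esym.
  have [_ ws _] := iw; apply: sv_le_zero_eq => //.
  (* The face of the complement of [i] lies between the wall and the chamber, so its zero set is
     [[set k]] or empty; the latter would make it the chamber, which [sw] excludes. *)
  have := sv_le_zero vw; rewrite vk (sv_zero_wall s_full) finset.subset1.
  move=> /orP[/eqP ->//|/eqP w0]; case/negP: sw.
  by rewrite (sv_le_zero_eq ws) ?sv_le_refl// w0 s_full.
have /choice[g gP] : forall k, exists i : 'I_4, k \in facets a s ->
    exists v, svec a v = wall s k /\ face (~: [set i])%SET v.
  move=> k; have [/coatom[i iP]|_] := boolP (k \in facets a s); first by exists i.
  by exists ord0.
rewrite -(card_ord 4) -(@card_in_imset _ _ g (mem (facets a s))) ?max_card//.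
move=> k l /gP[v [vk [v0 vs vS]]] /gP[w [wl [w0 ws wS]]] gkl.
have /(face_inj a_ess v0 w0 vs ws) : cell a (svec a v) = cell a (svec a w).
  by rewrite -vS -wS gkl.
rewrite vk wl => /(congr1 (@sv_zero I)).
by rewrite !(sv_zero_wall s_full) => /finset.set1_inj.
Qed.

End Tetrahedron.

(** * Counting *)

Section Counting.
Context (R : realType) (n : nat) (I : finType) (a : I -> 'cV[R]_n.+1).
Local Notation sv := {ffun I -> option bool}.
Hypothesis a_neq0 : forall i, a i != 0.
Implicit Types (v w : 'rV[R]_n.+1) (s t : sv).

(** Inverse to [wall] on one side: for a wall [t] in plane [k], the adjacent chamber on side [b]. *)
Definition set_sign k b t : sv := [ffun i => if i == k then Some b else t i].

Lemma set_sign_wall s k b : s k = Some b -> set_sign k b (wall s k) = s.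
Proof. by move=> sk; apply/ffunP => i; rewrite !ffunE; case: eqVneq => // ->. Qed.

Lemma wall_set_sign t k b : t k = None -> wall (set_sign k b t) k = t.
Proof. by move=> tk; apply/ffunP => i; rewrite !ffunE; case: eqVneq => // ->. Qed.

Lemma covector_set_sign t k b : sv_zero t = [set k]%SET -> covector a t ->
  covector a (set_sign k b t).
Proof.
move=> tk /covectorP[v vt]; have [d dk] := col_neq0P (a_neq0 k).
have [e ek] : exists e, sign (ev a k e) = Some b.
  have : sign (ev a k d) != None by rewrite sign_eq0.
  case dE : (sign _) => [c|//] _; have [<-|cb] := eqVneq c b; first by exists d.
  by exists (- d); rewrite evN signN dE; case: c b cb {dE} => -[].
have [u uE] : exists u, svec a u = sv_comp (svec a v) (svec a e).
  near (0 : R)^'+ => x; exists (v + x *: e); near: x; exact: svec_near.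
apply/covectorP; exists u; rewrite uE vt; apply/ffunP => i; rewrite !ffunE.
have /finset.setP/(_ i) := tk; rewrite !inE.
by case: (eqVneq i k) => [->|_]; [rewrite ek => /eqP ->|case: (t i)].
Unshelve. all: by end_near.
Qed.

(** On each side of plane [k], [wall] and [set_sign] are inverse bijections between the chambers
    having a wall there and those walls. *)
Lemma card_chambers_at_wall k :
  #|[set s in covectors a finset.set0 | k \in facets a s]%SET| =
  (2 * #|covectors a [set k]%SET|)%N.
Proof.
set B := [set s in _ | _]%SET.
have side b : #|[set s in B | s k == Some b]%SET| = #|covectors a [set k]%SET|.
  rewrite -(@card_in_imset _ _ (set_sign k b) (mem (covectors a [set k]%SET))).
    apply: eq_card => s; apply/idP/imsetP => [|[t]].
      rewrite !inE => /andP[/andP[/andP[s_cov /eqP s_full] sw] /eqP sk].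
      by exists (wall s k); rewrite ?set_sign_wall// inE sw (sv_zero_wall s_full) eqxx.
    rewrite !inE => /andP[t_cov /eqP tk] ->.
    have /eqP tkN : t k == None by have := finset.set11 k; rewrite -tk inE.
    rewrite covector_set_sign//= wall_set_sign// t_cov andbT ffunE eqxx.
    rewrite eqxx andbT; apply/eqP/finset.setP => i; rewrite !inE ffunE.
    have /finset.setP/(_ i) := tk; rewrite !inE.
    by case: (eqVneq i k).
  move=> t r; rewrite !inE => /andP[_ /eqP tk] /andP[_ /eqP rk].
  have kN q : sv_zero q = [set k]%SET -> q k = None.
    by move=> qk; apply/eqP; have := finset.set11 k; rewrite -qk inE.
  by move=> /(congr1 (fun s : sv => wall s k)); rewrite !wall_set_sign ?kN.
rewrite mul2n -addnn -{1}(side true) -(side false).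
rewrite -(cardsID [set s : sv | s k == Some true]%SET B).
congr addn; apply: eq_card => s; rewrite !inE //.
have [/finset.setP/(_ k)|] := eqVneq (sv_zero s) finset.set0; last by rewrite !andbF.
by rewrite !inE; case: (s k) => [[]|]; rewrite ?andbT ?andbF.
Qed.

(** Double counting of the incidences between chambers and their walls. *)
Lemma sum_card_facets :
  (\sum_(s in covectors a finset.set0) #|facets a s| =
   2 * \sum_k #|covectors a [set k]%SET|)%N.
Proof.
under eq_bigr do rewrite -sum1_card.
rewrite (exchange_big_dep predT)//= big_distrr /=; apply: eq_bigr => k _.
rewrite -card_chambers_at_wall -sum1_card; apply: eq_bigl => s.
by rewrite !inE.
Qed.

Lemma card_covectors Z : Z != finset.setT ->
  #|covectors a Z| = (2 * ncard (cell a @` [set` covectors a Z]))%N.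
Proof.
move=> ZT; apply: card_cells => [|s|s]; rewrite !inE.
- by rewrite sv_zero0 eq_sym (negPf ZT) andbF.
- by move=> /andP[/covectorP].
- by move=> /andP[sc sZ]; rewrite sv_zero_opp sZ covector_opp.
Qed.

End Counting.

(** * The count of two-dimensional cells and the simplicial criterion *)

Section Simplicial.
Context (R : realType) (I : finType) (a : I -> 'cV[R]_4).
Local Notation P := (proj_space R 4).
Hypothesis a_neq0 : forall i, a i != 0.
Hypothesis ker_inj : injective (fun i => proj_ker (a i)).
Hypothesis a_ess : forall v, svec a v = sv0 -> v = 0.
Let A : set (set P) := [set proj_ker (a i) | i in [set: I]].
Let r_restriction i :=
  num_chambers (proj_ker (a i)) (restriction A (proj_ker (a i))).

Let set1_neqT i : [set i]%SET != finset.setT :> {set I}.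
Proof.
apply/eqP => iT; have := card_planes_gt a_neq0 ker_inj a_ess.
by rewrite -finset.cardsT -iT finset.cards1.
Qed.

Let card_wall_covectors i : #|covectors a [set i]%SET| = (2 * r_restriction i)%N.
Proof.
rewrite /r_restriction /num_chambers (restriction_chambersE a_neq0 ker_inj a_ess)//.
exact: card_covectors.
Qed.

Lemma f2_sum_restriction : f2 A = (\sum_i r_restriction i)%N.
Proof.
(* The union is disjoint because the zero set determines [i]. Opposite pairs contribute a factor 2
   on both sides, which cancels. *)
pose D := (\bigcup_i covectors a [set i])%SET.
have DE : two_cells A = cell a @` [set` D].
  apply/seteqP; split=> [F [_ [i _ <-]]|_ [s /= /bigcupP[i _ si] <-]].
    rewrite (two_cellE a_neq0 ker_inj a_ess)// => -[s /= si <-].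
    by exists s => //=; apply/bigcupP; exists i.
  exists (proj_ker (a i)); first by exists i.
  by rewrite (two_cellE a_neq0 ker_inj a_ess)//; exists s.
apply/eqP; rewrite -(eqn_pmul2l (isT : 0 < 2)%N) /f2 DE -card_cells; first last.
- move=> s /bigcupP[i _]; rewrite inE => /andP[sc sZ].
  by apply/bigcupP; exists i => //; rewrite inE sv_zero_opp sZ covector_opp.
- by move=> s /bigcupP[i _]; rewrite inE => /andP[].
- apply/bigcupP => -[i _]; rewrite inE sv_zero0 => /andP[_].
  by rewrite eq_sym (negPf (set1_neqT i)).
rewrite -sum1_card partition_disjoint_bigcup /=; last first.
  move=> i j ij; rewrite -setI_eq0; apply/eqP/finset.setP => s; rewrite !inE.
  apply/negP => /andP[/andP[_ /eqP ->] /andP[_ /eqP/finset.set1_inj ji]].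
  by rewrite ji eqxx in ij.
rewrite big_distrr /=; apply/eqP/eq_bigr => i _.
by rewrite sum1_card card_wall_covectors.
Qed.

(** Every chamber has at least four walls, so the total number of walls attains its lower bound
    exactly when each chamber has four. *)
Lemma simplicial_sum_restriction :
  simplicial A <-> (\sum_i r_restriction i = 2 * num_chambers [set: P] A)%N.
Proof.
have chE := chambersE a_neq0 ker_inj a_ess.
have T0 : finset.set0 != finset.setT :> {set I}.
  rewrite eq_sym -finset.cards_eq0 finset.cardsT -lt0n.
  exact: leq_ltn_trans (card_planes_gt a_neq0 ker_inj a_ess).
pose D := covectors a finset.set0.
have DP s : s \in D -> covector a s /\ sv_zero s = finset.set0.
  by rewrite inE => /andP[sc /eqP].
have facets_ge s : s \in D -> (4 <= #|facets a s|)%N.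
  move=> /DP[sc sf].
  exact: (@card_facets_ge R 3 I a (covectors_independent a_neq0 ker_inj) a_ess s sc sf).
(* One factor 2 comes from the two sides of a wall, the other from the two sign vectors of a
   cell. *)
have sumE : (\sum_(s in D) #|facets a s| = 4 * \sum_i r_restriction i)%N.
  rewrite sum_card_facets// (eq_bigr _ (fun i _ => card_wall_covectors i)).
  by rewrite -big_distrr /= mulnA.
have cardD : #|D| = (2 * num_chambers [set: P] A)%N.
  by rewrite /num_chambers chE; exact: card_covectors.
have -> : simplicial A <-> forall s, s \in D -> #|facets a s| = 4.
  split=> [simp s sD|h C].
    have [sc sf] := DP _ sD; apply/eqP; rewrite eqn_leq facets_ge// andbT.
    apply: (tetrahedral_facets a_neq0 ker_inj a_ess sc sf); apply: simp.
    by rewrite chE; exists s.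
  rewrite chE => -[s /= sD <-]; have [sc sf] := DP _ sD.
  by apply: facets_tetrahedral => //; exact: h.
have leq : (\sum_(s in D) 4 <= \sum_(s in D) #|facets a s|
    ?= iff [forall (s | s \in D), 4 == #|facets a s|])%N.
  by apply: leqif_sum => s sD; split=> //; exact: facets_ge.
rewrite -cardD; split=> [h|h].
  apply/eqP; rewrite -(eqn_pmul2l (isT : 0 < 4)%N) -sumE.
  by rewrite (eq_bigr (fun=> 4)) ?sum_nat_const// mulnC.
move=> s sD; have := leq.2; rewrite sum_nat_const sumE h mulnC eqxx.
by move=> /esym/forall_inP/(_ s sD)/eqP.
Qed.

End Simplicial.

(** * From an arrangement to a family of covectors *)

Lemma svec_essential (R : realType) (n : nat) (I : finType) (a : I -> 'cV[R]_n.+1) :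
  essential [set proj_ker (a i) | i in [set: I]] ->
  forall v, svec a v = sv0 -> v = 0.
Proof.
move=> [X XA Xspan] v v0; have [//|vneq0] := eqVneq v 0.
have vX c : c \in X -> v *m c = 0.
  move=> /XA[_ [i _ iE]]; apply/(proj_kerP _ vneq0); rewrite -iE.
  apply/(proj_kerP _ vneq0)/ev_eq0/eqP.
  by rewrite -mem_sv_zero v0 sv_zero0 finset.in_setT.
(* The covectors vanishing at [v] form a subspace containing the spanning family [X], hence all
   coordinate forms. *)
have : (<<X>> <= lker (linfun (mulmx v)))%VS.
  by apply/span_subvP => c cX; rewrite memv_ker lfunE /= vX.
rewrite Xspan => /subvP full; apply/rowP => i.
have := full (delta_mx i 0) (memvf _); rewrite memv_ker lfunE /= -colE.
by move=> /eqP/colP/(_ 0); rewrite !mxE.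
Qed.

Theorem proposition3p2 (R : realType) (A : set (set (proj_space R 4)))
    (A_arr : arrangement A) (A_ess : essential A) :
  f2 A = (\sum_(H <- fset_set A) num_chambers H (restriction A H))%N /\
  (simplicial A <->
   (\sum_(H <- fset_set A) num_chambers H (restriction A H))%N =
   (2 * num_chambers [set: proj_space R 4] A)%N).
Proof.
have [A_fin A_ker] := A_arr.
(* The planes themselves serve as the index type, so distinct indices have distinct kernels. *)
have /choice[a aP] : forall H : fset_set A,
    exists c, (c != 0)%R /\ val H = proj_ker c.
  move=> H; have /A_ker[c c0 cE] : A (val H).
    by apply/set_mem; rewrite -in_fset_set// fsvalP.
  by exists c.
have a_neq0 H : (a H != 0)%R by have [] := aP H.
have kerE H : proj_ker (a H) = val H by have [_] := aP H.
have ker_inj : injective (fun H => proj_ker (a H)).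
  by move=> H K; rewrite !kerE; exact: val_inj.
have AE : [set proj_ker (a H) | H in [set: fset_set A]] = A.
  apply/seteqP; split=> [_ [H _ <-]|H AH].
    by rewrite kerE; apply/set_mem; rewrite -in_fset_set// fsvalP.
  have HA : H \in fset_set A by rewrite in_fset_set// mem_set.
  by exists [` HA]%fset; rewrite ?kerE.
have a_ess v : svec a v = sv0 -> v = 0%R.
  by apply: svec_essential; rewrite AE.
have sumE : (\sum_(H <- fset_set A) num_chambers H (restriction A H) =
    \sum_H num_chambers (proj_ker (a H)) (restriction A (proj_ker (a H))))%N.
  by rewrite big_seq_fsetE; apply: eq_bigr => H _; rewrite kerE.
have := f2_sum_restriction a_neq0 ker_inj a_ess.
have := simplicial_sum_restriction a_neq0 ker_inj a_ess.
by rewrite AE sumE => simpE f2E; split.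
Qed.
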